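(* Assume $\Phi:\mathbb{R}^n\to\mathbb{R}^n$ is Borel-measurable and invertible, and that both $\Phi$ and $\Phi^{-1}$ are shape-preserving. Then both $\Phi$ and $\Phi^{-1}$ are $A_2$-stable if and only if $\Phi$ is biLipschitz.
   Context: Cubes have sides parallel to the coordinate axes, $\ell(Q)$ is the side length. A map $\Phi:\mathbb{R}^n\to\mathbb{R}^n$ (not necessarily invertible) is shape-preserving if there is $K\ge1$ such that for every cube $Q\subset\mathbb{R}^n$ there are cubes $Q_{\mathrm{small}},Q_{\mathrm{big}}$ with $Q_{\mathrm{small}}\subset\Phi^{-1}(Q)\subset Q_{\mathrm{big}}$ and $\ell(Q_{\mathrm{big}})/\ell(Q_{\mathrm{small}})\le K$. For positive Borel measures, $A_2(\sigma,\omega)=\sup_Q\frac{\sigma(Q)}{|Q|}\frac{\omega(Q)}{|Q|}$, the supremum over all cubes $Q\subset\mathbb{R}^n$. The pushforward is $\Phi_*\mu(E)=\mu(\Phi^{-1}(E))$ for Borel $E$. A (Borel measurable) map $\Phi$ is $A_2$-stable if there is $C>0$ such that $A_2(\Phi_*\sigma,\Phi_*\omega)\le C\,A_2(\sigma,\omega)$ for every pair of locally finite positive Borel measures $\sigma,\omega$. $\Phi$ is biLipschitz if $\sup_{x\neq y}\frac{|\Phi(x)-\Phi(y)|}{|x-y|}+\sup_{x\neq y}\frac{|\Phi^{-1}(x)-\Phi^{-1}(y)|}{|x-y|}<\infty$. *)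

(* Defs.v *)
From mathcomp Require Import all_boot all_order all_algebra.
From mathcomp Require Import all_classical all_reals all_analysis.
Set Implicit Arguments.
Unset Strict Implicit.
Unset Printing Implicit Defensive.
Import Order.TTheory GRing.Theory Num.Theory.
Import numFieldNormedType.Exports.
Local Open Scope classical_set_scope.
Local Open Scope ring_scope.

(* R^n with its Borel sigma-algebra. *)
Notation borelRn R n := (g_sigma_algebraType (@open 'rV[R]_n)).

(* The library norm on 'rV[R]_n is the sup norm; this is the Euclidean one. *)
Definition enorm (R : realType) (n : nat) (x : 'rV[R]_n) : R :=
  Num.sqrt (\sum_(i < n) x ord0 i ^+ 2).

(* Axis-parallel cubes are taken closed and nondegenerate. *)
Record cube (R : realType) (n : nat) := Cube {
  corner : 'rV[R]_n;
  side : R;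
  side_gt0 : 0 < side }.

Definition cube_set (R : realType) (n : nat) (Q : cube R n) : set 'rV[R]_n :=
  [set x | forall i : 'I_n,
     corner Q ord0 i <= x ord0 i <= corner Q ord0 i + side Q].

Definition cube_vol (R : realType) (n : nat) (Q : cube R n) : R := side Q ^+ n.

Definition shape_preserving (R : realType) (n : nat)
    (Phi : 'rV[R]_n -> 'rV[R]_n) : Prop :=
  exists2 K : R, 1 <= K & forall Q : cube R n, exists Qsmall Qbig : cube R n,
    [/\ cube_set Qsmall `<=` Phi @^-1` cube_set Q,
        Phi @^-1` cube_set Q `<=` cube_set Qbig &
        side Qbig / side Qsmall <= K].

(* The value may be +oo; the product of \bar R satisfies 0 * +oo = 0. *)
Definition A2 (R : realType) (n : nat)
    (sigma omega : set (borelRn R n) -> \bar R) : \bar R :=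
  ereal_sup [set (sigma (cube_set Q) * ((cube_vol Q)^-1)%:E *
                  (omega (cube_set Q) * ((cube_vol Q)^-1)%:E))%E
            | Q in [set: cube R n]].

Definition locally_finite (R : realType) (n : nat)
    (mu : set (borelRn R n) -> \bar R) : Prop :=
  forall x : 'rV[R]_n, exists2 U : set 'rV[R]_n,
    open_nbhs x U & (mu U < +oo)%E.

(* Borel measurability is part of the notion: without it the pushforwards
   need not be Borel measures. *)
Definition A2_stable (R : realType) (n : nat)
    (Phi : borelRn R n -> borelRn R n) : Prop :=
  measurable_fun [set: borelRn R n] Phi /\
  exists2 C : R, 0 < C &
    forall sigma omega : {measure set (borelRn R n) -> \bar R},
      locally_finite sigma -> locally_finite omega ->
      (A2 (pushforward sigma Phi) (pushforward omega Phi)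
         <= C%:E * A2 sigma omega)%E.

Definition sup_quotient (R : realType) (n : nat)
    (f : 'rV[R]_n -> 'rV[R]_n) : \bar R :=
  ereal_sup [set (enorm (f p.1 - f p.2) / enorm (p.1 - p.2))%:E
            | p in [set p : 'rV[R]_n * 'rV[R]_n | p.1 != p.2]].

(* Psi stands for the inverse of Phi. *)
Definition biLipschitz (R : realType) (n : nat)
    (Phi Psi : 'rV[R]_n -> 'rV[R]_n) : Prop :=
  (sup_quotient Phi + sup_quotient Psi < +oo)%E.

(* Main.v *)
Require Import Defs.
From mathcomp Require Import all_boot all_order all_algebra.
From mathcomp Require Import all_classical all_reals all_analysis.
From mathcomp Require Import lra.
Import Order.TTheory GRing.Theory Num.Theory.
Import numFieldNormedType.Exports.
Local Open Scope classical_set_scope.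
Local Open Scope ring_scope.

(** Stability of [Phi] is tested on pairs of point masses. For distinct points
    [x] and [y], the cubes that contribute to the A2 characteristic of the two
    Dirac masses are those containing both points, so the characteristic equals
    [d ^ (- 2 n)], where [d] is the sup distance of [x] and [y] (lemma
    [A2_dirac]). A map sends Dirac masses to Dirac masses; hence an A2-stable
    injective map cannot bring points much closer together than they were, which
    is to say that its inverse is Lipschitz ([A2_stable_expanding]).
    Stability of [Phi] thus bounds [Psi], and stability of [Psi] bounds [Phi].

    Conversely, if [Psi] is Lipschitz with constant [L], the preimage of a cube
    of side [s] under [Phi] is its image under [Psi], which lies in a cube of
    side [2 L s]. Passing to that cube costs a factor [(2 L) ^ n] for the average
    of each measure ([lipschitz_inverse_A2_stable]). In this direction the
    measurability of [Psi] comes from its continuity.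

    All estimates are carried out in the sup norm, whose balls are cubes;
    [sup_quotient_ltyP] translates them to the Euclidean norm. *)

Lemma sup_norm_leP (R : realType) (n : nat) (x : 'rV[R]_n) (r : R) :
  0 <= r -> `|x| <= r <-> forall i, `|x ord0 i| <= r.
Proof.
move=> r0; rewrite [ `|x|]/Num.Def.normr/= mx_normrE; split.
  by move=> /bigmax_leP[_ xr] i; exact: (xr (ord0, i)).
by move=> xr; apply/bigmax_leP; split=> // -[i j] _ /=; rewrite ord1.
Qed.

Lemma coord_le_sup_norm (R : realType) (n : nat) (x : 'rV[R]_n) (i : 'I_n) :
  `|x ord0 i| <= `|x|.
Proof. by apply (@sup_norm_leP R n x `|x|). Qed.

Lemma sup_norm_le_enorm (R : realType) (n : nat) (x : 'rV[R]_n) :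
  `|x| <= enorm x.
Proof.
apply/sup_norm_leP => [|i]; first exact: sqrtr_ge0.
rewrite -sqrtr_sqr ler_wsqrtr// (bigD1 i)//= lerDl.
by apply: sumr_ge0 => j _; exact: sqr_ge0.
Qed.

Lemma enorm_le_sup_norm (R : realType) (n : nat) (x : 'rV[R]_n) :
  enorm x <= n%:R * `|x|.
Proof.
rewrite -[leRHS]ger0_norm ?mulr_ge0// -sqrtr_sqr ler_wsqrtr//.
apply: (@le_trans _ _ (\sum_(i < n) `|x| ^+ 2)).
  apply: ler_sum => i _; rewrite -real_normK ?num_real//.
  by rewrite lerXn2r ?nnegrE// coord_le_sup_norm.
rewrite sumr_const card_ord -[leLHS]mulr_natl exprMn ler_wpM2r ?sqr_ge0//.
by rewrite -natrX ler_nat -{1}(expn1 n); case: n {x} => // n; rewrite leq_pexp2l.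
Qed.

(** Cubes as sup-norm balls: this gives both their closedness and the
    cubes with prescribed center. *)
Lemma cube_setE (R : realType) (n : nat) (Q : cube R n) :
  cube_set Q = closed_ball_ (@Num.norm _ 'rV[R]_n)
    (corner Q + const_mx (side Q / 2)) (side Q / 2).
Proof.
have s0 := side_gt0 Q.
apply/seteqP; split=> x; rewrite /closed_ball_/= => xQ.
  apply/sup_norm_leP => [|i]; first lra.
  by have := xQ i; rewrite !mxE ler_norml => ?; lra.
move=> i; move/sup_norm_leP: xQ => /(_ ltac:(lra) i).
by rewrite !mxE ler_norml => ?; lra.
Qed.

Lemma measurable_cube (R : realType) (n : nat) (Q : cube R n) :
  measurable (cube_set Q : set (borelRn R n)).
Proof.
(* The sigma-algebra is generated by open sets, hence the complement. *)
rewrite -(setCK (cube_set Q)); apply: measurableC.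
apply: sub_sigma_algebra; rewrite openC cube_setE.
exact: closed_closed_ball_.
Qed.

Lemma cube_dist (R : realType) (n : nat) (Q : cube R n) (x y : 'rV[R]_n) :
  cube_set Q x -> cube_set Q y -> `|x - y| <= side Q.
Proof.
move=> xQ yQ; apply/sup_norm_leP => [|i]; first exact/ltW/side_gt0.
by have := xQ i; have := yQ i; rewrite !mxE ler_norml => ? ?; lra.
Qed.

Lemma cube_through (R : realType) (n : nat) (x y : 'rV[R]_n) :
  x != y -> exists Q : cube R n,
    [/\ cube_set Q x, cube_set Q y & side Q = `|x - y|].
Proof.
rewrite -subr_eq0 -normr_gt0 => xy.
exists (Cube (\row_i Num.min (x ord0 i) (y ord0 i)) xy); split=> //= i /=;
  rewrite mxE; have := coord_le_sup_norm _ _ (x - y) i;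
  rewrite !mxE ler_norml; case: (leP (x ord0 i) (y ord0 i)) => ? ?; lra.
Qed.

Lemma cube_around (R : realType) (n : nat) (c : 'rV[R]_n) (r : R) :
  0 < r -> exists2 Q : cube R n,
    cube_set Q = closed_ball_ (@Num.norm _ 'rV[R]_n) c r & side Q = 2 * r.
Proof.
move=> r0; have s0 : 0 < 2 * r by rewrite mulr_gt0.
exists (Cube (c - const_mx r) s0) => //; rewrite cube_setE /=.
by rewrite [2 * r]mulrC mulfK ?pnatr_eq0// subrK.
Qed.

Lemma lipschitz_measurable (R : realType) (n : nat)
    (f : 'rV[R]_n -> 'rV[R]_n) (L : R) : 0 < L ->
  (forall x y, `|f x - f y| <= L * `|x - y|) ->
  measurable_fun [set: borelRn R n] (f : borelRn R n -> borelRn R n).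
Proof.
move=> L0 fL; have cf : continuous f.
  move=> x; apply/(@cvgrPdist_le R 'rV[R]_n _ (nbhs x) (nbhs_filter x)) => e e0.
  apply/(@nbhs_normP R 'rV[R]_n).
  exists (e / L) => [|y /= /ltW xy]; first exact: divr_gt0.
  by apply: (le_trans (fL _ _)); rewrite mulrC -ler_pdivlMr.
apply: (@measurability _ _ (borelRn R n) (borelRn R n) _ _ (@open 'rV[R]_n)) => // _ [A oA <-].
rewrite setTI; apply: sub_sigma_algebra.
by move/continuousP : cf; exact.
Qed.

(** Clearing denominators turns the comparison of the A2 characteristics of
    two pairs of point masses, at distances [a] and [b], into
    [b ^ (2 n) <= C a ^ (2 n)]. The constant [C + 1], being at least 1, is below
    its own power of exponent [2 n], so no root needs to be extracted. *)
Lemma le_of_invX_le (R : realType) (n : nat) (a b : R) : (0 < n)%N ->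
  0 < a -> 0 < b ->
  forall C, 0 < C ->
  (a ^+ n)^-1 * (a ^+ n)^-1 <= C * ((b ^+ n)^-1 * (b ^+ n)^-1) ->
  b <= (C + 1) * a.
Proof.
move=> n0 a0 b0 C C0; rewrite -!invfM -!expr2 -!exprM => h.
have n2 : (0 < n * 2)%N by rewrite muln_gt0 n0.
have C1 : 0 <= C + 1 by rewrite addr_ge0// ltW.
rewrite -(@ler_pXn2r _ (n * 2)) ?nnegrE ?mulr_ge0 ?(ltW a0) ?(ltW b0)//.
rewrite exprMn; move: h.
rewrite ler_pdivlMr ?exprn_gt0// mulrC ler_pdivrMr ?exprn_gt0// => h.
apply: (le_trans h); rewrite ler_wpM2r ?exprn_ge0 ?(ltW a0)//.
apply: (@le_trans _ _ (C + 1)); first by rewrite lerDl.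
by rewrite ler_eXnr// lerDr ltW.
Qed.

(** Only cubes containing both points contribute, and among those the supremum
    is attained by a smallest one, whose side is the sup distance. *)
Lemma A2_dirac (R : realType) (n : nat) (x y : borelRn R n) : x != y ->
  A2 \d_x \d_y =
  ((`|x - y : 'rV[R]_n| ^+ n)^-1 * (`|x - y : 'rV[R]_n| ^+ n)^-1)%:E.
Proof.
move=> xy; apply/eqP; rewrite eq_le; apply/andP; split; last first.
  have [Q [xQ yQ sQ]] := cube_through R n x y xy.
  apply: ereal_sup_ubound; exists Q => //.
  by rewrite !diracE !mem_set// /cube_vol sQ !mul1e EFinM.
apply: ge_ereal_sup => _ [Q _ <-].
have xy0 : 0 < `|x - y : 'rV[R]_n| by rewrite normr_gt0 subr_eq0.
rewrite !diracE -!EFinM lee_fin /cube_vol.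
have [xQ|_] := boolP (x \in _); last by rewrite !mul0r mulr_ge0 ?invr_ge0.
have [yQ|_] := boolP (y \in _); last by rewrite mul0r mulr0 mulr_ge0 ?invr_ge0.
have le_side : (side Q ^+ n)^-1 <= (`|x - y : 'rV[R]_n| ^+ n)^-1.
  rewrite lef_pV2 ?posrE ?exprn_gt0 ?side_gt0//.
  rewrite lerXn2r ?nnegrE ?(ltW xy0) ?(ltW (side_gt0 Q))//.
  by apply: cube_dist; exact: set_mem.
by rewrite !mul1r ler_pM ?invr_ge0 ?exprn_ge0 ?(ltW (side_gt0 Q)).
Qed.

Lemma locally_finite_dirac (R : realType) (n : nat) (x : borelRn R n) :
  locally_finite (\d_x : set (borelRn R n) -> \bar R).
Proof.
move=> y; exists setT; last by rewrite diracT ltry.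
by split=> //; exact: openT.
Qed.

(** Stability applied to the point masses at [x] and [y] compares the negative
    powers of the two distances, which reverses the inequality: the image
    distance is bounded from below. *)
Lemma A2_stable_expanding (R : realType) (n : nat)
    (f : 'rV[R]_n -> 'rV[R]_n) : (0 < n)%N -> injective f -> A2_stable f ->
  exists2 L : R, 0 < L & forall x y, `|x - y| <= L * `|f x - f y|.
Proof.
move=> n0 finj [_ [C C0 stab]]; exists (C + 1) => [|x y]; first exact: addr_gt0.
have [->|xy] := eqVneq x y; first by rewrite !subrr !normr0 mulr0.
have fxy : f x != f y by rewrite (inj_eq finj).
apply: (@le_of_invX_le _ n) => //; rewrite ?normr_gt0 ?subr_eq0//.
(* The pushforward of a point mass is the point mass at the image. *)
have stab_xy : (A2 \d_(f x : borelRn R n) \d_(f y : borelRn R n) <=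
                C%:E * A2 \d_(x : borelRn R n) \d_(y : borelRn R n))%E.
  exact: stab _ _ (locally_finite_dirac _ _ x) (locally_finite_dirac _ _ y).
by move: stab_xy; rewrite !A2_dirac// -EFinM lee_fin.
Qed.

(** The preimage of a cube lies in a sup-norm ball around the image under [g] of
    its corner; that ball is a cube of proportional side, over which the averages
    are controlled by the A2 characteristic. *)
Lemma lipschitz_inverse_A2_stable (R : realType) (n : nat)
    (f g : 'rV[R]_n -> 'rV[R]_n) (L : R) : cancel f g ->
  measurable_fun [set: borelRn R n] (f : borelRn R n -> borelRn R n) ->
  0 < L -> (forall x y, `|g x - g y| <= L * `|x - y|) ->
  A2_stable f.
Proof.
move=> fK mf L0 gL; split => //.
have c0 : 0 < (2 * L) ^+ n by rewrite exprn_gt0// mulr_gt0.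
exists ((2 * L) ^+ n * (2 * L) ^+ n) => [|sigma omega _ _]; first exact: mulr_gt0.
apply: ge_ereal_sup => _ [Q _ <-].
have s0 := side_gt0 Q.
have [Q' Q'E sQ'] := cube_around R n (g (corner Q)) (L * side Q) (mulr_gt0 L0 s0).
have sub : f @^-1` cube_set Q `<=` cube_set Q'.
  move=> x xQ; rewrite Q'E /closed_ball_/= -{1}(fK x).
  apply: (le_trans (gL _ _)); rewrite ler_pM2l//.
  apply: cube_dist => // i; have := xQ i => ?; lra.
(* Each measure loses the ratio of the volumes of [Q'] and [Q]. *)
have avg (mu : {measure set (borelRn R n) -> \bar R}) :
    (pushforward mu (f : borelRn R n -> borelRn R n) (cube_set Q) * ((cube_vol Q)^-1)%:E <=
     ((2 * L) ^+ n)%:E * (mu (cube_set Q') * ((cube_vol Q')^-1)%:E))%E.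
  have -> : (cube_vol Q)^-1 = (2 * L) ^+ n * (cube_vol Q')^-1.
    by rewrite /cube_vol sQ' mulrA [(2 * L * _) ^+ n]exprMn invfM mulVKf// gt_eqF.
  rewrite EFinM muleCA lee_pmul2l// lee_wpmul2r//.
    by rewrite lee_fin invr_ge0 exprn_ge0// ltW// side_gt0.
  apply: (le_measure mu _ _ sub); rewrite inE; last exact: measurable_cube.
  rewrite -[X in measurable X]setTI; apply: mf => //; exact: measurable_cube.
have vol0 (P : cube R n) : (0 <= ((cube_vol P)^-1)%:E)%E.
  by rewrite lee_fin invr_ge0 exprn_ge0// ltW// side_gt0.
apply: (le_trans (lee_pmul _ _ (avg sigma) (avg omega))).
- by apply: mule_ge0 => //; exact: (measure_ge0 sigma).
- by apply: mule_ge0 => //; exact: (measure_ge0 omega).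
rewrite muleACA -EFinM lee_pmul2l//; last by rewrite lte_fin mulr_gt0.
by apply: ereal_sup_ubound; exists Q'.
Qed.

(** Finiteness of the Euclidean difference quotients amounts to a Lipschitz
    bound in the sup norm, the two norms being equivalent. Taking [L] positive
    lets it serve as a scaling factor for sides of cubes. *)
Lemma sup_quotient_ltyP (R : realType) (n : nat)
    (f : 'rV[R]_n -> 'rV[R]_n) :
  (sup_quotient f < +oo)%E <->
  exists2 L : R, 0 < L & forall x y, `|f x - f y| <= L * `|x - y|.
Proof.
have e0 (x y : 'rV[R]_n) : x != y -> 0 < enorm (x - y).
  rewrite -subr_eq0 -normr_gt0 => xy.
  exact: lt_le_trans xy (sup_norm_le_enorm R n _).
split=> [supf|[L L0 fL]]; last first.
  apply: (@le_lt_trans _ _ (n%:R * L)%:E); last exact: ltry.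
  apply: ge_ereal_sup => _ [[x y] /= xy <-]; rewrite lee_fin ler_pdivrMr ?e0//.
  apply: (le_trans (enorm_le_sup_norm _ _ _)); rewrite -mulrA ler_wpM2l//.
  by apply: (le_trans (fL _ _)); rewrite ler_pM2l// sup_norm_le_enorm.
pose M := `|fine (sup_quotient f)|.
(* The factor [n] compares the norms; adding 1 makes the constant positive. *)
exists (M * n%:R + 1) => [|x y]; first by rewrite ltr_wpDl ?mulr_ge0 ?normr_ge0.
have [->|xy] := eqVneq x y; first by rewrite !subrr !normr0 mulr0.
apply: (@le_trans _ _ (M * n%:R * `|x - y|)); last first.
  by rewrite ler_wpM2r// lerDl.
rewrite -mulrA; apply: (le_trans (sup_norm_le_enorm _ _ _)).
apply: (@le_trans _ _ (M * enorm (x - y))); last first.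
  by rewrite ler_wpM2l ?normr_ge0// enorm_le_sup_norm.
rewrite -ler_pdivrMr ?e0// -lee_fin.
apply: (@le_trans _ _ (sup_quotient f)).
  by apply: ereal_sup_ubound; exists (x, y).
by move: supf; rewrite /M; case: (sup_quotient f) => [r _|//|_] /=;
  rewrite ?leNye// lee_fin ler_norm.
Qed.

(** In positive dimension there are distinct points, so the supremum is not
    the empty one; this prevents [-oo] from absorbing the other summand in
    the sum defining biLipschitz maps. *)
Lemma sup_quotient_ge0 (R : realType) (n : nat)
    (f : 'rV[R]_n -> 'rV[R]_n) : (0 < n)%N -> (0 <= sup_quotient f)%E.
Proof.
case: n f => // n f _; apply: (@le_trans _ _
    (enorm (f (const_mx 1) - f 0) / enorm (const_mx 1 - 0 : 'rV[R]_n.+1))%:E).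
  by rewrite lee_fin divr_ge0// sqrtr_ge0.
apply: ereal_sup_ubound; exists (const_mx 1, 0) => //=.
by apply/eqP => /rowP/(_ ord0); rewrite !mxE => /eqP; rewrite oner_eq0.
Qed.

Theorem corollary51 (R : realType) (n : nat) (n_gt0 : (0 < n)%N)
    (Phi Psi : 'rV[R]_n -> 'rV[R]_n)
    (PhiK : cancel Phi Psi) (PsiK : cancel Psi Phi)
    (mPhi : measurable_fun [set: borelRn R n]
              (Phi : borelRn R n -> borelRn R n))
    (spPhi : shape_preserving Phi) (spPsi : shape_preserving Psi) :
  (A2_stable Phi /\ A2_stable Psi) <-> biLipschitz Phi Psi.
Proof.
have Phi_ge0 := sup_quotient_ge0 R n Phi n_gt0.
have Psi_ge0 := sup_quotient_ge0 R n Psi n_gt0.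
split=> [[stPhi stPsi]|fin].
  apply: lte_add_pinfty; apply/sup_quotient_ltyP.
    have [L L0 PsiL] := A2_stable_expanding R n Psi n_gt0 (can_inj PsiK) stPsi.
    by exists L => // x y; have := PsiL (Phi x) (Phi y); rewrite !PhiK.
  have [L L0 PhiL] := A2_stable_expanding R n Phi n_gt0 (can_inj PhiK) stPhi.
  by exists L => // x y; have := PhiL (Psi x) (Psi y); rewrite !PsiK.
have /sup_quotient_ltyP[L L0 PhiL] : (sup_quotient Phi < +oo)%E.
  by apply: le_lt_trans fin; rewrite leeDl.
have /sup_quotient_ltyP[M M0 PsiM] : (sup_quotient Psi < +oo)%E.
  by apply: le_lt_trans fin; rewrite leeDr.
split; first exact: (lipschitz_inverse_A2_stable _ _ _ _ _ PhiK mPhi M0 PsiM).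
apply: (lipschitz_inverse_A2_stable _ _ _ _ _ PsiK _ L0 PhiL).
exact: lipschitz_measurable M0 PsiM.
Qed.
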